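(* Let $f:\mathbb R^d\to\mathbb R$ be convex and differentiable with $L$-Lipschitz gradient, let $x^\star\in\arg\min f$, and let $R>0$ satisfy $R\ge\|x_0-x^\star\|$. Fix a horizon $T\ge1$ and set $$a_t=\frac{t+1}{128L},\quad A_t=\sum_{i=0}^t a_i=\frac{(t+1)(t+2)}{256L},\quad \theta_t=\frac{a_t}{A_t}=\frac{2}{t+2},\qquad 0\le t\le T,$$ $$m_0=0,\qquad m_t=\frac{\theta_t(1-\theta_{t-1})}{\theta_{t-1}}=\frac{t-1}{t+2},\qquad 1\le t\le T,$$ $$H_{T-1}:=\sqrt{\sum_{i=0}^{T-1}a_i^2},\qquad \beta:=1+\frac{\sigma}{R}H_{T-1}.$$ Run the one-step delayed algorithm described in the context with these parameters, and assume its stochastic oracle satisfies the conditional-bias, centered-variance and square-integrability assumptions in the context with noise level $\sigma$ and deterministic RMS bias bounds $\epsilon_0,\dots,\epsilon_{T-1}\ge0$. Then $$\mathbb E[f(x_T)-f(x^\star)]\le\frac{6\sigma R}{\sqrt T}+\frac{128LR^2}{T^2}+\mathcal E_T,$$ where $$\mathcal E_T:=2^{11}\left(R+\sqrt{\frac{\sigma R}{L}}\,T^{3/4}\right)T\,\Gamma_T+\frac{64}{L}T^4\Gamma_T^2,\qquad \Gamma_T:=\frac{1}{A_{T-1}}\sum_{t=0}^{T-1}a_t\epsilon_t.$$ If $\epsilon_t=0$ for all $t$, then $\mathcal E_T=0$ and the last term vanishes.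
   Context: Algorithm (one-step delayed momentum-compensated accelerated stochastic approximation). Input $x_0\in\mathbb R^d$, horizon $T$, parameters $(a_t,\theta_t)$, $(m_t)_{t=0}^T$, $\beta>0$. Set $z_0=x_0$, $x_{-1}=x_0$, $q_0=x_0$. For $t=0,1,\dots,T-1$: $q_{t+1}=x_t+m_t(1+m_{t+1})(x_t-x_{t-1})$ (submitted as the next query); receive the delayed stochastic gradient $G_t=G(q_t,\xi_t)$ of the previously submitted query $q_t$; $z_{t+1}=z_t-\frac{a_t}{\beta}G_t$; $x_{t+1}=(1-\theta_t)x_t+\theta_tz_{t+1}$. Output $x_T$. Oracle assumptions. Write $G_t=\nabla f(q_t)+\zeta_t$. Let $\mathcal F_t$ be the $\sigma$-algebra containing all randomness and all iterates available before $G_t$ is revealed (in particular $q_t$ is $\mathcal F_t$-measurable). With $b_t:=\mathbb E[\zeta_t\mid\mathcal F_t]$, assume for $0\le t<T$: $\mathbb E\|b_t\|^2\le\epsilon_t^2$, $\ \mathbb E[\|\zeta_t-b_t\|^2\mid\mathcal F_t]\le\sigma^2$, and $\mathbb E\|G(q_t,\xi_t)\|^2<\infty$, where $\epsilon_0,\dots,\epsilon_{T-1}$ are deterministic nonnegative numbers. $\|\cdot\|$ is the Euclidean norm. *)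

(* Defs.v *)
From HB Require Import structures.
From mathcomp Require Import all_boot all_order all_algebra.
From mathcomp Require Import all_classical all_reals all_analysis.
From mathcomp Require Import zify ring lra.

Set Implicit Arguments.
Unset Strict Implicit.
Unset Printing Implicit Defensive.

Import Order.TTheory GRing.Theory Num.Theory.
Import numFieldNormedType.Exports.

Local Open Scope classical_set_scope.
Local Open Scope ring_scope.

(* The library norm `|v| on 'rV[R]_d is the sup norm, hence this one. *)
Definition enorm (R : realType) (d : nat) (v : 'rV[R]_d) : R :=
  Num.sqrt (\sum_(i < d) v 0 i ^+ 2).

Definition gradient (R : realType) (d : nat) (f : 'rV[R]_d -> R)
    (x : 'rV[R]_d) : 'rV[R]_d :=
  \row_(i < d) 'd f x (delta_mx 0 i).

Section Measurability.
Context {d0 : measure_display} {Omega : measurableType d0}.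

(* Sub-sigma-algebras of Omega are represented by their sets of events. *)
Definition sub_sigma_algebra_of (F : set (set Omega)) : Prop :=
  sigma_algebra [set: Omega] F /\ F `<=` measurable.

Definition measurable_wrt (F : set (set Omega)) {d1 : measure_display}
    {U : measurableType d1} (Y : Omega -> U) : Prop :=
  forall B : set U, measurable B -> F (Y @^-1` B).

(* 'rV[R]_d carries no measurable structure in the library: measurability of a
   random vector is measurability of its coordinates. *)
Definition vmeasurable_wrt (F : set (set Omega)) {R : realType} {d : nat}
    (Y : Omega -> 'rV[R]_d) : Prop :=
  forall i : 'I_d, measurable_wrt F (fun w => Y w 0 i).

(* Y is a version of E[X | F]. *)
Definition is_condexp {R : realType} (P : probability Omega R)
    (F : set (set Omega)) (X Y : Omega -> R) : Prop :=
  [/\ P.-integrable [set: Omega] (EFin \o X),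
      measurable_wrt F Y,
      P.-integrable [set: Omega] (EFin \o Y) &
      forall A, F A ->
        (\int[P]_(w in A) (Y w)%:E = \int[P]_(w in A) (X w)%:E)%E].

Definition is_vcondexp {R : realType} {d : nat} (P : probability Omega R)
    (F : set (set Omega)) (X Y : Omega -> 'rV[R]_d) : Prop :=
  forall i : 'I_d, is_condexp P F (fun w => X w 0 i) (fun w => Y w 0 i).

End Measurability.

(* State at time t: x_{t-1}, x_t, z_t and the query q_t, which has been
   submitted but whose gradient has not been received yet. *)
Record iterates (R : realType) (d : nat) := Iterates {
  it_xprev : 'rV[R]_d;
  it_x : 'rV[R]_d;
  it_z : 'rV[R]_d;
  it_q : 'rV[R]_d }.

Section Algorithm.
Context {R : realType} {d : nat}.
Context (a theta m : nat -> R) (beta : R) (x0 : 'rV[R]_d).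

(* [grad t q] is the stochastic gradient G(q, xi_t) along a fixed outcome. *)
Definition delayed_step (grad : nat -> 'rV[R]_d -> 'rV[R]_d) (t : nat)
    (s : iterates R d) : iterates R d :=
  let: Iterates xprev x z q := s in
  let q' := x + (m t * (1 + m t.+1)) *: (x - xprev) in
  let z' := z - (a t / beta) *: grad t q in
  let x' := (1 - theta t) *: x + theta t *: z' in
  Iterates x x' z' q'.

Fixpoint delayed_iter (grad : nat -> 'rV[R]_d -> 'rV[R]_d) (t : nat)
    : iterates R d :=
  if t is s.+1 then delayed_step grad s (delayed_iter grad s)
  else Iterates x0 x0 x0 x0.

End Algorithm.

Section StepSizes.
Context {R : realType}.
Context (L : R).

Definition step_a (t : nat) : R := t.+1%:R / (128 * L).

Definition sum_A (t : nat) : R := \sum_(i < t.+1) step_a i.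

Definition weight_theta (t : nat) : R := step_a t / sum_A t.

Definition momentum (t : nat) : R :=
  if t is s.+1 then weight_theta s.+1 * (1 - weight_theta s) / weight_theta s
  else 0.

(* [step_norm T] is H_{T-1}. *)
Definition step_norm (T : nat) : R := Num.sqrt (\sum_(i < T) step_a i ^+ 2).

Definition damping (sigma r : R) (T : nat) : R := 1 + sigma / r * step_norm T.

(* Gamma_T, meaningful for 1 <= T. *)
Definition mean_bias (eps : nat -> R) (T : nat) : R :=
  (\sum_(t < T) step_a t * eps t) / sum_A T.-1.

Definition bias_error (sigma r : R) (eps : nat -> R) (T : nat) : R :=
  2 ^+ 11 * (r + Num.sqrt (sigma * r / L) * (T%:R `^ (3 / 4)))
    * T%:R * mean_bias eps T
  + 64 / L * T%:R ^+ 4 * mean_bias eps T ^+ 2.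

Lemma sum_AE (t : nat) : sum_A t = t.+1%:R * t.+2%:R / (256 * L).
Proof.
have E k : step_a k = k.+1%:R * (128 * L)^-1 by [].
have -> : (256 * L)^-1 = 2^-1 * (128 * L)^-1 :> R.
  by rewrite -invfM mulrA -natrM.
elim: t => [|t IH].
  by rewrite /sum_A big_ord1 E !mul1r mulrA divff ?mul1r ?pnatr_eq0.
rewrite /sum_A big_ord_recr /= -/(sum_A t) IH E !mulrA -mulrDl.
congr (_ * _); apply: (mulIf (x := 2)); first by rewrite pnatr_eq0.
by rewrite mulrDl !mulfVK ?pnatr_eq0// -!natrM -natrD; congr _%:R; nia.
Qed.

Lemma weight_thetaE (t : nat) : 0 < L -> weight_theta t = 2 / t.+2%:R.
Proof.
move=> L0; have l0 : 128 * L != 0 by rewrite mulf_neq0 ?gt_eqF.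
rewrite /weight_theta sum_AE /step_a.
have -> : 256 * L = 2 * (128 * L) by rewrite mulrA -natrM.
move: (128 * L) l0 => l l0.
have t1 : t.+1%:R != 0 :> R by rewrite pnatr_eq0.
have t2 : t.+2%:R != 0 :> R by rewrite pnatr_eq0.
move: t.+1%:R t.+2%:R t1 t2 => u v u0 v0.
by field; rewrite u0 v0 l0.
Qed.

Lemma momentumE (t : nat) :
  0 < L -> (1 <= t)%N -> momentum t = (t%:R - 1) / (t%:R + 2).
Proof.
case: t => // t L0 _; rewrite /= !weight_thetaE //.
have t2 : t.+2%:R != 0 :> R by rewrite pnatr_eq0.
have t3 : t.+3%:R != 0 :> R by rewrite pnatr_eq0.
have -> : t.+1%:R + 2 = t.+3%:R :> R by rewrite -natrD addn2.
have -> : t.+1%:R - 1 = t.+2%:R - 2 :> R by rewrite -[t.+2]addn1 natrD; ring.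
move: t.+2%:R t.+3%:R t2 t3 => u v u0 v0.
by field; rewrite u0 v0.
Qed.

End StepSizes.

Section Run.
Context {d0 d1 : measure_display} {Omega : measurableType d0}
  {Xi : measurableType d1} {R : realType} {d : nat}.

(* The iterates of the run with horizon T as random variables. *)
Definition accel_run (L sigma r : R) (T : nat) (x0 : 'rV[R]_d)
    (G : 'rV[R]_d -> Xi -> 'rV[R]_d) (xi : nat -> Omega -> Xi)
    (t : nat) (w : Omega) : iterates R d :=
  delayed_iter (step_a L) (weight_theta L) (momentum L) (damping L sigma r T) x0
    (fun s q => G q (xi s w)) t.

Definition response (G : 'rV[R]_d -> Xi -> 'rV[R]_d) (xi : nat -> Omega -> Xi)
    (run : nat -> Omega -> iterates R d) (t : nat) (w : Omega) : 'rV[R]_d :=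
  G (it_q (run t w)) (xi t w).

Definition oracle_error (f : 'rV[R]_d -> R) (G : 'rV[R]_d -> Xi -> 'rV[R]_d)
    (xi : nat -> Omega -> Xi) (run : nat -> Omega -> iterates R d)
    (t : nat) (w : Omega) : 'rV[R]_d :=
  response G xi run t w - gradient f (it_q (run t w)).

(* F contains everything available before the gradient at q_t is revealed;
   q_{t+1} is included since it is computed and submitted before that. *)
Definition contains_past (G : 'rV[R]_d -> Xi -> 'rV[R]_d)
    (xi : nat -> Omega -> Xi) (run : nat -> Omega -> iterates R d)
    (t : nat) (F : set (set Omega)) : Prop :=
  [/\ forall s, (s < t)%N -> measurable_wrt F (xi s),
      forall s, (s < t)%N -> vmeasurable_wrt F (response G xi run s),
      forall s, (s <= t)%N -> vmeasurable_wrt F (fun w => it_x (run s w)),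
      forall s, (s <= t)%N -> vmeasurable_wrt F (fun w => it_z (run s w)) &
      forall s, (s <= t.+1)%N -> vmeasurable_wrt F (fun w => it_q (run s w))].

(* F t is the information before the t-th response; b t is a version of
   E[zeta_t | F t]. *)
Definition oracle_assumptions (P : probability Omega R) (f : 'rV[R]_d -> R)
    (G : 'rV[R]_d -> Xi -> 'rV[R]_d) (xi : nat -> Omega -> Xi)
    (run : nat -> Omega -> iterates R d) (F : nat -> set (set Omega))
    (b : nat -> Omega -> 'rV[R]_d) (sigma : R) (eps : nat -> R) (T : nat)
    : Prop :=
  let zeta := oracle_error f G xi run in
  forall t, (t < T)%N ->
  [/\ sub_sigma_algebra_of (F t) /\ contains_past G xi run t (F t),
      vmeasurable_wrt measurable (response G xi run t) /\
        ('E_P[fun w => (enorm (response G xi run t w) ^+ 2)%R] < +oo)%E,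
      is_vcondexp P (F t) (zeta t) (b t),
      ('E_P[fun w => (enorm (b t w) ^+ 2)%R] <= (eps t ^+ 2)%:E)%E &
      exists V : Omega -> R,
        is_condexp P (F t) (fun w => enorm (zeta t w - b t w) ^+ 2) V /\
        {ae P, forall w, V w <= sigma ^+ 2}].

End Run.

(* Main.v *)
Require Import Defs.
From HB Require Import structures.
From mathcomp Require Import all_boot all_order all_algebra.
From mathcomp Require Import all_classical all_reals all_analysis.
From mathcomp Require Import measurable_realfun.
From mathcomp Require Import ring lra.

Set Implicit Arguments.
Unset Strict Implicit.
Unset Printing Implicit Defensive.

Import Order.TTheory GRing.Theory Num.Theory.
Import numFieldNormedType.Exports.

Local Open Scope classical_set_scope.
Local Open Scope ring_scope.

(* The momentum is tuned so that x_{t+1} - q_t = theta_t (z_{t+1} - z_t)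
   + (1 + m_t) theta_{t-1} (z_t - z_{t-1}): the delay costs one extra step of z.
   Hence, along each outcome, the potential
     A_{t-1} (f x_t - f x* ) + beta/2 |z_t - x*|^2 + 1/8 |z_t - z_{t-1}|^2
   grows at step t by at most a_t^2 |eta_t|^2 / (2 lambda)
   - a_t <eta_t, z_t - x*> - a_t <b_t, z_{t+1} - x*>, where eta_t is the centered
   noise and lambda = beta - 5/16. In expectation the first inner product
   vanishes, z_t being F_t-measurable, and the second is at most
   a_t eps_t (K / 2 + E |z_{t+1} - x*|^2 / (2 K)) for every K > 0. With
   S = sum_t a_t eps_t and K = 2 R + 2 S, the inequality for the largest
   E |z_n - x*|^2 bounds it by K^2, so that
   A_{T-1} E [f x_T - f x*] <= R^2 / 2 + sigma R H_{T-1} + S K. *)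

(** * Euclidean inner product and norm of row vectors *)

Definition dotv (R : realType) (d : nat) (u v : 'rV[R]_d) : R :=
  \sum_(i < d) u 0 i * v 0 i.

Lemma enorm_sqr (R : realType) (d : nat) (u : 'rV[R]_d) :
  enorm u ^+ 2 = \sum_(i < d) u 0 i ^+ 2.
Proof. by rewrite sqr_sqrtr// sumr_ge0// => i _; rewrite sqr_ge0. Qed.

Lemma enorm_ge0 (R : realType) (d : nat) (u : 'rV[R]_d) : 0 <= enorm u.
Proof. exact: sqrtr_ge0. Qed.

Lemma enorm0 (R : realType) (d : nat) : enorm (0 : 'rV[R]_d) = 0.
Proof. by rewrite /enorm big1 ?sqrtr0// => i _; rewrite mxE expr0n. Qed.

Lemma dotvBC (R : realType) (d : nat) (u x y : 'rV[R]_d) :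
  dotv u (x - y) = - dotv u (y - x).
Proof. by rewrite /dotv -sumrN; apply: eq_bigr => i _; rewrite !mxE; ring. Qed.

(** Expanding the square of [u - v - L w] gives [2 L <u - v, w> <= |u - v|^2 + L^2 |w|^2 <= 2 L^2
    |w|^2], which stands in for Cauchy-Schwarz. *)
Lemma dotv_le_lipschitz (R : realType) (d : nat) (L : R) (u v w : 'rV[R]_d) :
  0 < L -> enorm (u - v) <= L * enorm w ->
  dotv u w <= dotv v w + L * enorm w ^+ 2.
Proof.
move=> L_gt0 uvw.
have g2 : enorm (u - v) ^+ 2 <= L ^+ 2 * enorm w ^+ 2.
  by rewrite -exprMn ler_pXn2r ?nnegrE ?mulr_ge0 ?enorm_ge0// ltW.
have : 0 <= \sum_(i < d) ((u - v) 0 i - L * w 0 i) ^+ 2.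
  by apply: sumr_ge0 => i _; rewrite sqr_ge0.
rewrite (eq_bigr (fun i => (u - v) 0 i ^+ 2
    + L ^+ 2 * (w 0 i ^+ 2) + - (2 * L) * (u 0 i * w 0 i)
    + (2 * L) * (v 0 i * w 0 i))); last first.
  by move=> i _; rewrite !mxE; ring.
rewrite !big_split/= -!mulr_sumr -!enorm_sqr -/(dotv _ _) -/(dotv _ _) => H.
rewrite -(ler_pM2l (mulr_gt0 (ltr0n R 2) L_gt0)).
have e : 2 * L * (L * enorm w ^+ 2) = 2 * (L ^+ 2 * enorm w ^+ 2) by ring.
rewrite mulrDr e; move: H g2.
by move: (dotv u w) (dotv v w) (enorm _ ^+ 2) (L ^+ 2 * _) => p q z t; lra.
Qed.

(** Meant for [u], [v] the gradients at [y], [x] and for [a = f x], [b = f y]: the last hypothesis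
    is then convexity at [y]. *)
Lemma dotv_step (R : realType) (d : nat) (L a b : R) (u v x y : 'rV[R]_d) :
  0 < L -> enorm (u - v) <= L * enorm (y - x) ->
  b + dotv u (x - y) <= a ->
  b <= a + dotv v (y - x) + L * enorm (y - x) ^+ 2.
Proof.
move=> L_gt0 /(dotv_le_lipschitz L_gt0); rewrite (dotvBC u x y).
by move: (dotv u _) (dotv v _) (L * _) => p q r; lra.
Qed.

(** * First-order inequalities for a convex smooth function *)

Section FirstOrder.
Context {R : realType} {d : nat} (f : 'rV[R]_d -> R).

Lemma diff_gradient (x v : 'rV[R]_d) :
  differentiable f x -> 'd f x v = dotv (gradient f x) v.
Proof.
move=> df; rewrite [v in LHS]row_sum_delta linear_sum; apply: eq_bigr => i _.
by rewrite linearZ /= mxE mulrC.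
Qed.

Context (f_convex : convex_function [set: convex_lmodType 'rV[R]_d] f)
  (f_differentiable : forall x, differentiable f x).

(** For [0 < h <= 1], convexity bounds the difference quotient of [f] along [y - x] by [f y - f x];
    its limit at [0] from the right is the directional derivative. *)
Lemma convex_gradient_le (x y : 'rV[R]_d) :
  f x + dotv (gradient f x) (y - x) <= f y.
Proof.
rewrite -diff_gradient// -deriveE// addrC -lerBrDr.
have /cvg_dnbhs_at_right dv := diff_derivable (v := y - x) (f_differentiable x).
apply: (cvgr_to_le (F := 0^'+) dv); near=> h.
have h0 : 0 < h by near: h; exact: nbhs_right_gt.
have h1 : h <= 1 by near: h; apply: nbhs_right_ltW.
rewrite /= -[_ *: _]/(_ * _) mulrC ler_pdivrMr// lerBlDr.
have cvx : f (h *: y + (1 - h) *: x) <= h * f y + (1 - h) * f x.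
  by have := @f_convex (Itv01 (ltW h0) h1) y x; rewrite !inE; exact.
move: cvx; rewrite (_ : h *: y + (1 - h) *: x = h *: (y - x) + x); last first.
  by rewrite scalerBr scalerBl scale1r -addrA; congr (_ + _); rewrite addrC.
by rewrite /=; lra.
Unshelve. all: by end_near. Qed.

Context (L : R) (L_gt0 : 0 < L) (f_smooth : forall x y,
  enorm (gradient f x - gradient f y) <= L * enorm (x - y)).

(* Convexity at the endpoint replaces the integral form of Taylor's formula, at
   the price of the constant L instead of L / 2. *)
Lemma convex_smooth_le (x y : 'rV[R]_d) :
  f y <= f x + dotv (gradient f x) (y - x) + L * enorm (y - x) ^+ 2.
Proof.
exact: dotv_step L_gt0 (f_smooth y x) (convex_gradient_le y x).
Qed.

End FirstOrder.

(** * Exact identities of the delayed recursion *)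

Section DelayedIterates.
Context {R : realType} {d : nat}.
Context (a theta m : nat -> R) (beta : R) (x0 : 'rV[R]_d).
Context (grad : nat -> 'rV[R]_d -> 'rV[R]_d).

Let s := delayed_iter a theta m beta x0 grad.

Lemma it_zS t :
  it_z (s t.+1) = it_z (s t) - (a t / beta) *: grad t (it_q (s t)).
Proof. by rewrite /s /= -/s; case: (s t). Qed.

Lemma it_xS t :
  it_x (s t.+1) = (1 - theta t) *: it_x (s t) + theta t *: it_z (s t.+1).
Proof. by rewrite /s /= -/s; case: (s t). Qed.

Lemma it_xprevS t : it_xprev (s t.+1) = it_x (s t).
Proof. by rewrite /s /= -/s; case: (s t). Qed.

Lemma it_qS t : it_q (s t.+1) =
  it_x (s t) + (m t * (1 + m t.+1)) *: (it_x (s t) - it_xprev (s t)).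
Proof. by rewrite /s /= -/s; case: (s t). Qed.

Context (theta_neq0 : forall t, theta t != 0).
Context (m_recursion :
  forall t, m t.+1 = theta t.+1 * (1 - theta t) / theta t).

(** Both [x_t - x_{t-1}] and [z_t - x_t] are multiples of [z_t - x_{t-1}], by [theta_{t-1}] and
    [1 - theta_{t-1}]; [m_recursion] matches the two factors. *)
Lemma momentum_invariant t :
  m t *: (it_x (s t) - it_xprev (s t)) = theta t *: (it_z (s t) - it_x (s t)).
Proof.
case: t => [|t]; first by rewrite /s /= subrr !scaler0.
rewrite it_xprevS it_xS m_recursion; apply/rowP => i; rewrite !mxE.
by field; rewrite theta_neq0.
Qed.

Lemma iterate_sub_query t :
  it_x (s t.+1) - it_q (s t) = theta t *: (it_z (s t.+1) - it_z (s t)) +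
    ((1 + m t) * theta t.-1) *: (it_z (s t) - it_z (s t.-1)).
Proof.
(* The first step has no delay: [q_0 = x_0], and since [0.-1 = 0] the second term on the right
   vanishes. *)
case: t => [|t].
  rewrite subrr scaler0 addr0 it_xS; move: (it_z (s 1)) => z1.
  by apply/rowP => i; rewrite /s !mxE /=; ring.
(* The invariant turns the query into [q_{t+1} = x_t + (1 + m_{t+1}) theta_t (z_t - x_t)], after
   which everything is expressed by [x_t] and the [z] iterates and [x_t] cancels. *)
have e := momentum_invariant t.
rewrite it_qS it_xS [it_x (s t.+1)]it_xS [m t * _]mulrC.
rewrite -[(_ * m t) *: _]scalerA e m_recursion.
move: (it_z (s t.+2)) (it_z (s t.+1)) (it_z (s t)) (it_x (s t)) => z2 z1 z x.
by apply/rowP => i; rewrite !mxE; field; rewrite theta_neq0.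
Qed.

End DelayedIterates.

(** * Constants obtained from the step sizes *)

Section Weights.
Context {R : realType} (L : R) (L_gt0 : 0 < L).

Lemma step_a_gt0 t : 0 < step_a L t.
Proof. by rewrite divr_gt0 ?mulr_gt0. Qed.

Lemma sum_A_gt0 t : 0 < sum_A L t.
Proof. by rewrite sum_AE divr_gt0 ?mulr_gt0. Qed.

Lemma weight_theta_neq0 t : weight_theta L t != 0.
Proof. by rewrite gt_eqF// divr_gt0 ?step_a_gt0 ?sum_A_gt0. Qed.

(** The left-hand side equals [(t + 1) / (32 (t + 2))]. It is the weight of [|z_{t+1} - z_t|^2] in
    the smoothness error, the factor [2] coming from [(u + v)^2 <= 2 u^2 + 2 v^2]. *)
Lemma current_weight_le t : 2 * (sum_A L t * L * weight_theta L t ^+ 2) <= 1 / 32.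
Proof.
rewrite weight_thetaE// sum_AE.
have -> : t.+2%:R = t%:R + 2 :> R by rewrite -natrD addn2.
have -> : t.+1%:R = t%:R + 1 :> R by rewrite natr1.
have := ler0n R t; move: (t%:R) => u u0.
rewrite [leLHS](_ : _ = 1 / 32 * ((u + 1) / (u + 2))); last first.
  by field; rewrite !gt_eqF//; lra.
suff : (u + 1) / (u + 2) <= 1 by lra.
by rewrite ler_pdivrMr; lra.
Qed.

(** For [t >= 1] the left-hand side is [(2 t + 1)^2 / (32 (t + 1) (t + 2))]. The bound [1 / 8] is
    the weight of [|z_t - z_{t-1}|^2] in the potential, which thus pays for the delay. *)
Lemma delayed_weight_le t :
  2 * (sum_A L t * L * ((1 + momentum L t) * weight_theta L t.-1) ^+ 2) <= 1 / 8.
Proof.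
(* At [t = 0] the momentum is [0], not the value [-1/2] of its closed form, and [theta_{t-1}] is
   read as [theta_0 = 1]. *)
case: t => [|t].
  rewrite /= weight_thetaE// sum_AE.
  rewrite [leLHS](_ : _ = 1 / 64); first by lra.
  by field; rewrite gt_eqF.
rewrite momentumE// weight_thetaE// sum_AE [t.+1.-1]/=.
have -> : t.+3%:R = t%:R + 3 :> R by rewrite -natrD addn3.
have -> : t.+2%:R = t%:R + 2 :> R by rewrite -natrD addn2.
have -> : t.+1%:R = t%:R + 1 :> R by rewrite natr1.
have := ler0n R t; move: (t%:R) => u u0.
rewrite [leLHS](_ : _ = 1 / 32 * ((2 * u + 3) ^+ 2 / ((u + 2) * (u + 3)))); last first.
  by field; rewrite !gt_eqF//; lra.
suff : (2 * u + 3) ^+ 2 / ((u + 2) * (u + 3)) <= 4 by lra.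
by rewrite ler_pdivrMr; nra.
Qed.

End Weights.

(** * One-step inequality for the potential *)

(** Add the two convexity inequalities with weights [A] and [a] to the upper bound on [fx'] with
    weight [A + a]; as [(A + a) x' = A x + a z'], the inner products with [g] collapse to
    [a <g, z' - w>]. *)
Lemma estimate_sequence_step (R : realType) (d : nat)
    (A a theta fq fx fx' fw e : R) (g x x' z' q w : 'rV[R]_d) :
  0 <= A -> 0 < a -> theta = a / (A + a) ->
  x' = (1 - theta) *: x + theta *: z' ->
  fx' <= fq + dotv g (x' - q) + e ->
  fq + dotv g (x - q) <= fx -> fq + dotv g (w - q) <= fw ->
  (A + a) * (fx' - fw) <=
    A * (fx - fw) + a * dotv g (z' - w) + (A + a) * e.
Proof.
move=> A0 a0 thE x'E h' h hw.
have S0 : 0 < A + a by lra.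
have lin : (A + a) * dotv g (x' - q) =
    A * dotv g (x - q) + a * dotv g (w - q) + a * dotv g (z' - w).
  rewrite /dotv !mulr_sumr -!big_split /=; apply: eq_bigr => i _.
  by rewrite x'E thE !mxE; field; rewrite gt_eqF.
have := ler_wpM2l (ltW S0) h'; have := ler_wpM2l A0 h; have := ler_wpM2l (ltW a0) hw.
move: lin.
by move: (dotv _ _) (dotv _ _) (dotv _ _) (dotv _ _) => u v y t; lra.
Qed.

(** One coordinate of the [z] update. Everything is quadratic and separable, so this scalar version
    can be summed over coordinates. *)
Lemma mirror_step (R : realFieldType) (a beta lambda g h b z z' w Dp : R) :
  0 < lambda -> lambda <= beta - 5 / 16 ->
  z' = z - a / beta * (g + h + b) ->
  a * (g * (z' - w)) + (1 / 32 * (z' - z) ^+ 2 + 1 / 8 * Dp ^+ 2)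
    + (beta / 2 * (z' - w) ^+ 2 + 1 / 8 * (z' - z) ^+ 2) <=
  (beta / 2 * (z - w) ^+ 2 + 1 / 8 * Dp ^+ 2)
    + (a ^+ 2 / (2 * lambda) * h ^+ 2 - a * (h * (z - w)) - a * (b * (z' - w))).
Proof.
move=> l0 lb z'E.
have b0 : beta != 0 by rewrite gt_eqF//; lra.
(* This is exactly the right-hand side minus the left-hand side. The first square is Young's
   inequality for [h] against [z' - z]; in the second, [5 / 16 = 2 (1 / 32 + 1 / 8)] accounts for
   the two multiples of [(z' - z)^2] on the left. *)
have : 0 <= (lambda * (z' - z) + a * h) ^+ 2 / (2 * lambda)
      + (beta - 5 / 16 - lambda) / 2 * (z' - z) ^+ 2.
  apply: addr_ge0; first by rewrite divr_ge0 ?sqr_ge0//; lra.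
  by rewrite mulr_ge0 ?sqr_ge0//; lra.
move=> H; rewrite -subr_ge0; move: H; congr (_ <= _).
by rewrite z'E; field; rewrite b0 gt_eqF.
Qed.

(** The smoothness error [L |x' - q|^2] splits into two displacements of [z]: the current one is
    absorbed by [mirror_step], the previous one by the [1 / 8] term of the old potential. *)
Lemma potential_step (R : realType) (d : nat)
    (A a theta c L beta lambda fq fx fx' fw : R)
    (g h b x x' z z' zp q w : 'rV[R]_d) :
  0 <= A -> 0 < a -> 0 <= L -> 0 < lambda -> lambda <= beta - 5 / 16 ->
  theta = a / (A + a) ->
  x' = (1 - theta) *: x + theta *: z' ->
  x' - q = theta *: (z' - z) + c *: (z - zp) ->
  z' = z - (a / beta) *: (g + h + b) ->
  2 * ((A + a) * L * theta ^+ 2) <= 1 / 32 ->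
  2 * ((A + a) * L * c ^+ 2) <= 1 / 8 ->
  fx' <= fq + dotv g (x' - q) + L * enorm (x' - q) ^+ 2 ->
  fq + dotv g (x - q) <= fx -> fq + dotv g (w - q) <= fw ->
  (A + a) * (fx' - fw) + (beta / 2 * enorm (z' - w) ^+ 2
    + 1 / 8 * enorm (z' - z) ^+ 2) <=
  A * (fx - fw) + (beta / 2 * enorm (z - w) ^+ 2 + 1 / 8 * enorm (z - zp) ^+ 2)
    + (a ^+ 2 / (2 * lambda) * enorm h ^+ 2 - a * dotv h (z - w)
       - a * dotv b (z' - w)).
Proof.
move=> A0 a0 L0 l0 lb thE x'E x'q z'E c1 c2 h1 h2 h3.
have := estimate_sequence_step A0 a0 thE x'E h1 h2 h3.
have quad : (A + a) * (L * enorm (x' - q) ^+ 2) <=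
    \sum_(i < d) (1 / 32 * ((z' - z) 0 i) ^+ 2 + 1 / 8 * ((z - zp) 0 i) ^+ 2).
  rewrite enorm_sqr x'q !mulr_sumr; apply: ler_sum => i _; rewrite !mxE.
  set u := z' 0 i - z 0 i; set v := z 0 i - zp 0 i.
  have uv : (theta * u + c * v) ^+ 2 <=
      2 * (theta ^+ 2 * u ^+ 2) + 2 * (c ^+ 2 * v ^+ 2).
    by have := sqr_ge0 (theta * u - c * v); lra.
  have AL : 0 <= (A + a) * L by rewrite mulr_ge0//; lra.
  have := ler_wpM2l AL uv.
  have := ler_wpM2r (sqr_ge0 u) c1; have := ler_wpM2r (sqr_ge0 v) c2.
  lra.
have coord : a * dotv g (z' - w) +
    \sum_(i < d) (1 / 32 * ((z' - z) 0 i) ^+ 2 + 1 / 8 * ((z - zp) 0 i) ^+ 2)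
    + (beta / 2 * enorm (z' - w) ^+ 2 + 1 / 8 * enorm (z' - z) ^+ 2) <=
    (beta / 2 * enorm (z - w) ^+ 2 + 1 / 8 * enorm (z - zp) ^+ 2)
    + (a ^+ 2 / (2 * lambda) * enorm h ^+ 2 - a * dotv h (z - w)
       - a * dotv b (z' - w)).
  rewrite !enorm_sqr /dotv !mulr_sumr -!sumrN -!big_split /=.
  apply: ler_sum => i _; rewrite !mxE.
  by apply: mirror_step => //; rewrite z'E !mxE.
move: quad coord; move: (A * _) (dotv _ _) (dotv _ _) (dotv _ _).
move: (\sum_(i < d) _) (beta / 2 * _) (beta / 2 * _) (1 / 8 * _) (1 / 8 * _).
move: (_ * enorm h ^+ 2) (L * _) => ? ? ? ? ? ? ? ? ? ? ?; lra.
Qed.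

(** * Telescoping of the potential along one outcome *)

Section PathwiseBound.
Context {R : realType} {d : nat} (f : 'rV[R]_d -> R).
Context (f_convex : convex_function [set: convex_lmodType 'rV[R]_d] f)
  (f_differentiable : forall x, differentiable f x).
Context (L : R) (L_gt0 : 0 < L) (f_smooth : forall x y,
  enorm (gradient f x - gradient f y) <= L * enorm (x - y)).
Context (beta lambda : R) (lambda_gt0 : 0 < lambda)
  (lambda_le : lambda <= beta - 5 / 16).
Context (x0 w : 'rV[R]_d) (grad : nat -> 'rV[R]_d -> 'rV[R]_d)
  (h b : nat -> 'rV[R]_d).

Let s := delayed_iter (step_a L) (weight_theta L) (momentum L) beta x0 grad.

(** The sum over [i < t] is [A_{t-1}] with the value [0] at [t = 0], whereas [sum_A L 0.-1] would be
    [a_0]. *)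
Let potential t :=
  (\sum_(i < t) step_a L i) * (f (it_x (s t)) - f w)
  + (beta / 2 * enorm (it_z (s t) - w) ^+ 2
     + 1 / 8 * enorm (it_z (s t) - it_z (s t.-1)) ^+ 2).

(** Only the centered noise is moved back from [z'] to [z], at the price of the quadratic term. The
    bias has no orthogonality to gain from this and stays paired with [z']. *)
Definition step_error (z z' : 'rV[R]_d) t :=
  step_a L t ^+ 2 / (2 * lambda) * enorm (h t) ^+ 2
  - step_a L t * dotv (h t) (z - w) - step_a L t * dotv (b t) (z' - w).

Lemma pathwise_bound n :
  (forall t, (t < n)%N ->
    grad t (it_q (s t)) = gradient f (it_q (s t)) + h t + b t) ->
  (\sum_(i < n) step_a L i) * (f (it_x (s n)) - f w)
    + beta / 2 * enorm (it_z (s n) - w) ^+ 2 <=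
  beta / 2 * enorm (x0 - w) ^+ 2
    + \sum_(t < n) step_error (it_z (s t)) (it_z (s t.+1)) t.
Proof.
move=> gradE.
(* The induction must carry the displacement term of the potential; being nonnegative, it is dropped
   only at the end. *)
suff : potential n <= beta / 2 * enorm (x0 - w) ^+ 2
    + \sum_(t < n) step_error (it_z (s t)) (it_z (s t.+1)) t.
  by apply: le_trans; rewrite /potential addrA lerDl mulr_ge0 ?sqr_ge0.
elim: n gradE => [|n IH] gradE.
  rewrite /potential !big_ord0 mul0r addr0 add0r subrr enorm0 expr0n mulr0.
  by rewrite addr0 /s /=.
rewrite big_ord_recr /= addrA.
apply: (le_trans _ (lerD (IH _) (lexx _))); last first.
  by move=> t tn; apply: gradE; apply: ltnW.
rewrite /potential big_ord_recr /=.
have A'E : \sum_(i < n) step_a L i + step_a L n = sum_A L n.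
  by rewrite /sum_A big_ord_recr.
apply: (@potential_step _ _ _ _ (weight_theta L n)
  ((1 + momentum L n) * weight_theta L n.-1) L beta lambda (f (it_q (s n))) _ _ _
  (gradient f (it_q (s n))) (h n) (b n) (it_x (s n)) (it_x (s n.+1)) _ _ _
  (it_q (s n))) => //.
- by apply: sumr_ge0 => i _; rewrite ltW// step_a_gt0.
- exact: step_a_gt0.
- exact: ltW.
- by rewrite A'E.
- exact: it_xS.
- apply: iterate_sub_query => [t|//]; exact: weight_theta_neq0.
- by rewrite it_zS -/s gradE.
- by rewrite A'E; exact: current_weight_le.
- by rewrite A'E; exact: delayed_weight_le.
- exact: convex_smooth_le.
- exact: convex_gradient_le.
- exact: convex_gradient_le.
Qed.

End PathwiseBound.

(** * Pulling a measurable factor out of a conditional expectation *)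

Section PullOut.
Context {d : measure_display} {T : measurableType d} {R : realType}
  (mu : {measure set T -> \bar R}) (F : set (set T)) (FT : sub_sigma_algebra_of F).

(** The same points with [F] as measurable sets, so that simple approximations taken on [G] have
    their level sets in [F]. *)
Let G := g_sigma_algebraType F.

Lemma measurable_g_sigma_algebraE (A : set T) :
  measurable (A : set G) <-> F A.
Proof. by rewrite measurable_g_measurableTypeE//; case: FT. Qed.

Lemma measurable_wrtW (d1 : measure_display) (U : measurableType d1) (Y : T -> U) :
  measurable_wrt F Y -> measurable_fun setT Y.
Proof. by move=> FY _ B mB; rewrite setTI; case: FT => _; apply; exact: FY. Qed.

Import HBNNSimple.

(** Reduces a simple weight to integrals of [W] over events of [F], the only integrals that a
    conditional expectation controls. *)
Lemma ge0_integral_mul_simple (phi : {nnsfun G >-> R}) (W : T -> R) :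
  measurable_fun setT W -> (forall x, 0 <= W x) ->
  (\int[mu]_x ((phi x)%:E * (W x)%:E) =
   \sum_(y \in range phi) y%:E * \int[mu]_(x in phi @^-1` [set y]) (W x)%:E)%E.
Proof.
move=> mW W0.
have mphi y : measurable (phi @^-1` [set y] : set T).
  case: FT => _; apply; apply/measurable_g_sigma_algebraE.
  by rewrite -[X in measurable X]setTI; exact: measurable_funP.
have mind y : measurable_fun setT
    (fun x : T => (y * \1_(phi @^-1` [set y]) x)%:E : \bar R).
  by apply/measurable_EFinP/measurable_funM.
transitivity (\int[mu]_x (\sum_(y \in range phi)
    ((y * \1_(phi @^-1` [set y]) x)%:E : \bar R) * (W x)%:E))%E.
  apply: eq_integral => x _.
  rewrite -ge0_mule_fsuml => [|y]; last exact: nnfun_muleindic_ge0.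
  by rewrite fsumEFin//; congr (_%:E * _)%E; exact: fimfunE.
rewrite ge0_integral_fsum//; last 2 first.
- move=> y; apply: emeasurable_funM => //; exact/measurable_EFinP.
- move=> y x _; apply: mule_ge0; last by rewrite lee_fin.
  exact: nnfun_muleindic_ge0.
apply: eq_fsbigr => y /[!inE] -[t _ <-].
under eq_integral do rewrite EFinM -muleA.
rewrite ge0_integralZl//; last 3 first.
- apply: emeasurable_funM; first exact/measurable_EFinP.
  exact/measurable_EFinP.
- by move=> x _; rewrite mule_ge0 ?lee_fin.
- by rewrite lee_fin.
congr (_ * _)%E.
rewrite -[in RHS](setTI (phi @^-1` _)) integral_mkcondr.
by apply: eq_integral => x _; rewrite epatch_indic muleC.
Qed.

(** Simple functions on [G] increase to [Z]; the equality holds for each of them and passes to the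
    limit by monotone convergence. *)
Lemma ge0_integral_mul_eq (W1 W2 Z : T -> R) :
  measurable_fun setT W1 -> measurable_fun setT W2 -> measurable_wrt F Z ->
  (forall x, 0 <= W1 x) -> (forall x, 0 <= W2 x) -> (forall x, 0 <= Z x) ->
  (forall A, F A -> \int[mu]_(x in A) (W1 x)%:E = \int[mu]_(x in A) (W2 x)%:E)%E ->
  (\int[mu]_x ((Z x)%:E * (W1 x)%:E) = \int[mu]_x ((Z x)%:E * (W2 x)%:E))%E.
Proof.
move=> mW1 mW2 FZ W10 W20 Z0 W12.
have mZ : measurable_fun setT (EFin \o (Z : G -> R)).
  apply/measurable_EFinP => _ B mB; rewrite setTI.
  by apply/measurable_g_sigma_algebraE; exact: FZ.
pose phi := nnsfun_approx measurableT mZ.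
have mphi n : measurable_fun setT (phi n : T -> R).
  move=> _ B mB; case: FT => _; apply; apply/measurable_g_sigma_algebraE.
  exact: measurable_funP.
have lim (W : T -> R) : measurable_fun setT W -> (forall x, 0 <= W x) ->
    (\int[mu]_x ((Z x)%:E * (W x)%:E) =
     limn (fun n => \int[mu]_x ((phi n x)%:E * (W x)%:E)))%E.
  move=> mW W0; rewrite -monotone_convergence//=.
  - apply: eq_integral => x _; apply/esym/cvg_lim => //.
    by apply: cvgeZr => //; apply: cvg_nnsfun_approx => // y _; rewrite lee_fin.
  - by move=> n; apply: emeasurable_funM; exact/measurable_EFinP.
  - by move=> n x _; rewrite mule_ge0 ?lee_fin.
  - move=> x _ a b ab; rewrite lee_wpmul2r ?lee_fin//.
    by have /lefP/(_ x) := nd_nnsfun_approx measurableT mZ ab.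
rewrite !lim//; congr (limn _); apply/funext => n.
rewrite !ge0_integral_mul_simple//; apply: eq_fsbigr => y _; congr (_ * _)%E.
apply: W12; apply/measurable_g_sigma_algebraE.
by rewrite -[X in measurable X]setTI; exact: measurable_funP.
Qed.

End PullOut.

Section Orthogonality.
Context {d : measure_display} {T : measurableType d} {R : realType}
  (P : probability T R).

(** Splitting both [X - Y] and [Z] into positive and negative parts reduces the claim to
    [ge0_integral_mul_eq]; integrability of the product keeps all four pieces finite. *)
Lemma condexp_orthogonal (F : set (set T)) (X Y Z : T -> R) :
  sub_sigma_algebra_of F -> is_condexp P F X Y -> measurable_wrt F Z ->
  P.-integrable setT (EFin \o (fun x => (X x - Y x) * Z x)) ->
  \int[P]_x ((X x - Y x) * Z x) = 0.
Proof.
move=> FT [iX FY iY XY] FZ iWZ.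
pose pos (h : T -> R) x := Num.max (h x) 0.
pose neg (h : T -> R) x := Num.max (- h x) 0.
have pos0 h x : 0 <= pos h x by rewrite /pos le_max lexx orbT.
have neg0 h x : 0 <= neg h x by rewrite /neg le_max lexx orbT.
have posneg h x : pos h x - neg h x = h x.
  by rewrite /pos /neg; case: (lerP (h x) 0) => ?; case: (lerP (- h x) 0) => ?; lra.
have posneg_abs h x : pos h x + neg h x = `|h x|.
  rewrite /pos /neg; case: (lerP (h x) 0) => h0.
    by rewrite ler0_norm//; case: (lerP (- h x) 0) => ?; lra.
  by rewrite gtr0_norm//; case: (lerP (- h x) 0) => ?; lra.
have pos_le h x : pos h x <= `|h x| by have := posneg_abs h x; have := neg0 h x; lra.
have neg_le h x : neg h x <= `|h x| by have := posneg_abs h x; have := pos0 h x; lra.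
have mpos h : measurable_fun setT h -> measurable_fun setT (pos h).
  by move=> mh; exact: measurable_maxr.
have mneg h : measurable_fun setT h -> measurable_fun setT (neg h).
  by move=> mh; apply: measurable_maxr => //; exact: measurableT_comp.
pose W x := X x - Y x.
have iW : P.-integrable setT (EFin \o W) by exact: integrableB iX iY.
have mW : measurable_fun setT W by apply/measurable_EFinP; exact: measurable_int iW.
have mZ : measurable_fun setT Z by exact: measurable_wrtW FZ.
have dom (h g : T -> R) : measurable_fun setT h -> (forall x, 0 <= h x <= `|g x|) ->
    P.-integrable setT (EFin \o g) -> P.-integrable setT (EFin \o h).
  move=> mh hg; apply: le_integrable => //; first exact/measurable_EFinP.
  move=> x _; rewrite lee_fin; have /andP[h0 ?] := hg x.
  by rewrite ger0_norm.
have ipos : P.-integrable setT (EFin \o pos W).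
  by apply: dom iW; [exact: mpos|move=> x; rewrite pos0 pos_le].
have ineg : P.-integrable setT (EFin \o neg W).
  by apply: dom iW; [exact: mneg|move=> x; rewrite neg0 neg_le].
(* The integral of [W] over an event of [F] is [0], and both parts of [W] are integrable, so their
   integrals agree. *)
have WA A : F A ->
    (\int[P]_(x in A) (pos W x)%:E = \int[P]_(x in A) (neg W x)%:E)%E.
  move=> FA; have mA : measurable A by case: FT => _; exact.
  have iS (h : T -> R) : P.-integrable setT (EFin \o h) -> P.-integrable A (EFin \o h).
    by apply: integrableS.
  have : (\int[P]_(x in A) (pos W x - neg W x)%:E = 0)%E.
    under eq_integral do rewrite posneg.
    rewrite integralB_EFin//; [|exact: iS..].
    by rewrite XY// subee// integrable_fin_num//; exact: iS.
  rewrite integralB_EFin//; [|exact: iS..].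
  have /fineK <- := integrable_fin_num mA (iS _ ipos).
  have /fineK <- := integrable_fin_num mA (iS _ ineg).
  by rewrite -EFinB => -[] /eqP; rewrite subr_eq0 => /eqP ->.
have FV (h : R -> R) : measurable_fun setT h -> measurable_wrt F (h \o Z).
  move=> mh B mB; rewrite comp_preimage; apply: FZ.
  by rewrite -[X in measurable X]setTI; exact: mh.
(* Here [V] stands for either part of [Z]; the products of [V] with the parts of [W] are dominated
   by [|W Z|]. *)
have null (V : T -> R) : measurable_wrt F V -> (forall x, 0 <= V x <= `|Z x|) ->
    P.-integrable setT (EFin \o (fun x => W x * V x)) /\ \int[P]_x (W x * V x) = 0.
  move=> FmV V0.
  have mV : measurable_fun setT V by exact: measurable_wrtW FmV.
  have iV (h : T -> R) : measurable_fun setT h -> (forall x, 0 <= h x <= `|W x|) ->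
      P.-integrable setT (EFin \o (fun x => V x * h x)).
    move=> mh hW; apply: dom iWZ; first exact: measurable_funM.
    move=> x; have /andP[h0 hx] := hW x; have /andP[v0 vx] := V0 x.
    by rewrite mulr_ge0//= mulrC normrM ler_pM.
  have iVpos : P.-integrable setT (EFin \o (fun x => V x * pos W x)).
    by apply: iV; [exact: mpos|move=> x; rewrite pos0 pos_le].
  have iVneg : P.-integrable setT (EFin \o (fun x => V x * neg W x)).
    by apply: iV; [exact: mneg|move=> x; rewrite neg0 neg_le].
  have WV : (fun x => W x * V x) = (fun x => V x * pos W x - V x * neg W x).
    by apply/funext => x; rewrite -mulrBr posneg mulrC.
  rewrite WV; split; first exact: integrableB iVpos iVneg.
  rewrite RintegralB//; apply/eqP; rewrite subr_eq0; apply/eqP; congr fine.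
  under eq_integral do rewrite EFinM.
  under [RHS]eq_integral do rewrite EFinM.
  apply: (ge0_integral_mul_eq FT) => //; [exact: mpos|exact: mneg|].
  by move=> x; case/andP: (V0 x).
have [ip ep] : P.-integrable setT (EFin \o (fun x => W x * pos Z x)) /\
    \int[P]_x (W x * pos Z x) = 0.
  apply: null => [|x]; last by rewrite pos0 pos_le.
  by apply: (FV (fun z => Num.max z 0)); exact: measurable_maxr.
have [in_ en] : P.-integrable setT (EFin \o (fun x => W x * neg Z x)) /\
    \int[P]_x (W x * neg Z x) = 0.
  apply: null => [|x]; last by rewrite neg0 neg_le.
  apply: (FV (fun z => Num.max (- z) 0)).
  by apply: measurable_maxr => //; exact: measurableT_comp.
under eq_Rintegral do rewrite -/(W _) -(posneg Z) mulrBr.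
by rewrite RintegralB// ep en subrr.
Qed.

End Orthogonality.

(** * Square-integrable variables and vectors *)

Section SquareIntegrable.
Context {d : measure_display} {T : measurableType d} {R : realType}
  (P : probability T R).
Implicit Types X Y : T -> R.

Let integr X := P.-integrable setT (EFin \o X).

Definition square_integrable X :=
  measurable_fun setT X /\ P.-integrable setT (EFin \o (fun x => X x ^+ 2)).

Lemma integrable_le_real X Y : measurable_fun setT X ->
  (forall x, `|X x| <= Y x) -> integr Y -> integr X.
Proof.
move=> mX XY; apply: le_integrable => //; first exact/measurable_EFinP.
by move=> x _; rewrite lee_fin (le_trans (XY x))// ler_norm.
Qed.

Lemma square_integrable_cst c : square_integrable (fun=> c).
Proof. by split => //; exact: finite_measure_integrable_cst. Qed.

Lemma square_integrableZ c X :
  square_integrable X -> square_integrable (fun x => c * X x).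
Proof.
move=> [mX iX]; split; first exact: measurable_funM.
have := integrableZl measurableT (c ^+ 2) iX.
by congr (_.-integrable _ _); apply/funext => x /=; rewrite exprMn EFinM.
Qed.

Lemma square_integrableD X Y : square_integrable X -> square_integrable Y ->
  square_integrable (fun x => X x + Y x).
Proof.
move=> sX sY; case: (sX) (sY) => mX _ [mY _]; split; first exact: measurable_funD.
(* The dominating function is [(2 X)^2 + (2 Y)^2]. *)
have [_ i1] := square_integrableZ 2 sX; have [_ i2] := square_integrableZ 2 sY.
apply: (integrable_le_real _ _ (integrableD measurableT i1 i2)).
  by apply: measurable_funX; exact: measurable_funD.
move=> x; rewrite ger0_norm ?sqr_ge0//=.
by have := sqr_ge0 (X x - Y x); have := sqr_ge0 (X x); have := sqr_ge0 (Y x); lra.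
Qed.

Lemma square_integrableB X Y : square_integrable X -> square_integrable Y ->
  square_integrable (fun x => X x - Y x).
Proof.
move=> sX /(square_integrableZ (-1)) /(square_integrableD sX).
by congr square_integrable; apply/funext => x; rewrite mulN1r.
Qed.

Lemma square_integrableM X Y : square_integrable X -> square_integrable Y ->
  integr (fun x => X x * Y x).
Proof.
move=> [mX iX] [mY iY].
apply: (integrable_le_real _ _ (integrableD measurableT iX iY)).
  exact: measurable_funM.
move=> x /=; have := sqr_ge0 (X x + Y x); have := sqr_ge0 (X x - Y x).
have := sqr_ge0 (X x); have := sqr_ge0 (Y x).
by rewrite ler_norml; move=> *; apply/andP; split; lra.
Qed.

Lemma Rintegral_sum (I : Type) (s : seq I) (h : I -> T -> R) :
  (forall i, integr (h i)) ->
  integr (fun x => \sum_(i <- s) h i x) /\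
  \int[P]_x (\sum_(i <- s) h i x) = \sum_(i <- s) \int[P]_x h i x.
Proof.
move=> ih; elim: s => [|i s [is_ es]].
  rewrite (_ : (fun x => _) = fun=> 0); last first.
    by apply/funext => x; rewrite big_nil.
  by rewrite big_nil Rintegral_cst// mul0r; split => //;
    apply: finite_measure_integrable_cst.
rewrite (_ : (fun x => _) = fun x => h i x + \sum_(j <- s) h j x); last first.
  by apply/funext => x; rewrite big_cons.
by rewrite big_cons (RintegralD _ (ih i) is_)// es; split => //;
  exact: integrableD (ih i) is_.
Qed.

Context (n : nat).
Implicit Types U V : T -> 'rV[R]_n.

Definition vsquare_integrable U := forall i, square_integrable (fun x => U x 0 i).

Lemma vsquare_integrableB U V : vsquare_integrable U -> vsquare_integrable V ->
  vsquare_integrable (fun x => U x - V x).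
Proof.
move=> sU sV i; have := square_integrableB (sU i) (sV i).
by congr square_integrable; apply/funext => x; rewrite !mxE.
Qed.

Lemma vsquare_integrableZ c U :
  vsquare_integrable U -> vsquare_integrable (fun x => c *: U x).
Proof.
move=> sU i; have := square_integrableZ c (sU i).
by congr square_integrable; apply/funext => x; rewrite !mxE.
Qed.

Lemma vsquare_integrable_cst u : vsquare_integrable (fun=> u).
Proof. by move=> i; exact: square_integrable_cst. Qed.

Lemma integrable_dotv U V : vsquare_integrable U -> vsquare_integrable V ->
  integr (fun x => dotv (U x) (V x)) /\
  \int[P]_x dotv (U x) (V x) = \sum_(i < n) \int[P]_x (U x 0 i * V x 0 i).
Proof.
move=> sU sV; rewrite /dotv.
have [] := @Rintegral_sum _ (index_enum 'I_n) (fun i x => U x 0 i * V x 0 i) _.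
  by move=> i; exact: square_integrableM.
by [].
Qed.

Lemma integrable_enorm_sqr U : vsquare_integrable U ->
  integr (fun x => enorm (U x) ^+ 2).
Proof.
move=> sU; have [+ _] := integrable_dotv sU sU.
by congr integr; apply/funext => x; rewrite enorm_sqr.
Qed.

Lemma measurable_enorm_sqr U :
  (forall i, measurable_fun setT (fun x => U x 0 i)) ->
  measurable_fun setT (fun x => enorm (U x) ^+ 2).
Proof.
move=> mU; rewrite (_ : (fun x => _) = fun x => \sum_(i < n) U x 0 i ^+ 2).
  by apply: measurable_sum => i; exact: measurable_funX.
by apply/funext => x; rewrite enorm_sqr.
Qed.

Lemma vsquare_integrable_enorm U :
  (forall i, measurable_fun setT (fun x => U x 0 i)) ->
  integr (fun x => enorm (U x) ^+ 2) -> vsquare_integrable U.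
Proof.
move=> mU iU i; split => //; apply: (integrable_le_real _ _ iU).
  exact: measurable_funX.
move=> x; rewrite ger0_norm ?sqr_ge0// enorm_sqr (bigD1 i)//= lerDl.
by apply: sumr_ge0 => j _; exact: sqr_ge0.
Qed.

Lemma vsquare_integrable_lty U :
  (forall i, measurable_fun setT (fun x => U x 0 i)) ->
  ('E_P[fun x => (enorm (U x) ^+ 2)%R] < +oo)%E -> vsquare_integrable U.
Proof.
move=> mU; rewrite unlock => Uoo; apply: vsquare_integrable_enorm => //.
apply/integrableP; split; first exact/measurable_EFinP/measurable_enorm_sqr.
by under eq_integral do rewrite /= ger0_norm ?sqr_ge0//.
Qed.

Lemma expectation_Rintegral X : integr X -> ('E_P[X])%E = (\int[P]_x X x)%:E.
Proof. by move=> iX; rewrite unlock fineK//; exact: integrable_fin_num. Qed.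

(* Cauchy-Schwarz in the form given by Young's inequality at the scale K. *)
Lemma Rintegral_dotv_ge (U V : T -> 'rV[R]_n) (e K : R) :
  vsquare_integrable U -> vsquare_integrable V -> 0 <= e -> 0 < K ->
  ('E_P[fun x => (enorm (U x) ^+ 2)%R] <= (e ^+ 2)%:E)%E ->
  - (\int[P]_x dotv (U x) (V x)) <=
    e * (K / 2 + (\int[P]_x enorm (V x) ^+ 2) / (2 * K)).
Proof.
move=> sU sV e0 K0 Ue.
have iU := integrable_enorm_sqr sU; have iV := integrable_enorm_sqr sV.
rewrite expectation_Rintegral// lee_fin in Ue.
set Q := \int[P]_x enorm (V x) ^+ 2.
have Q0 : 0 <= Q by apply: Rintegral_ge0 => x _; rewrite sqr_ge0.
have [iUV _] := integrable_dotv sU sV.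
have young c : 0 < c -> - (\int[P]_x dotv (U x) (V x)) <= e ^+ 2 / (2 * c) + c / 2 * Q.
  move=> c0.
  have iU' : integr (fun x => (2 * c)^-1 * enorm (U x) ^+ 2) by exact: integrableZl iU.
  have iV' : integr (fun x => c / 2 * enorm (V x) ^+ 2) by exact: integrableZl iV.
  have -> : - (\int[P]_x dotv (U x) (V x)) = \int[P]_x (- 1 * dotv (U x) (V x)).
    by rewrite RintegralZl// mulN1r.
  apply: (@le_trans _ _
    (\int[P]_x ((2 * c)^-1 * enorm (U x) ^+ 2 + c / 2 * enorm (V x) ^+ 2))).
    apply: le_Rintegral => //; [exact: integrableZl iUV|exact: integrableD iU' iV'|].
    move=> x _; rewrite !enorm_sqr /dotv !mulr_sumr -big_split; apply: ler_sum => i _.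
    rewrite /= -subr_ge0; move: (U x 0 i) (V x 0 i) => u v.
    rewrite [leRHS](_ : _ = (2 * c)^-1 * (u + c * v) ^+ 2); last first.
      by field; rewrite gt_eqF.
    by rewrite mulr_ge0 ?sqr_ge0// invr_ge0; lra.
  rewrite RintegralD// !RintegralZl// lerD2r mulrC ler_wpM2r// invr_ge0; lra.
(* The scale [c = e / K] turns [e^2 / (2 c)] into [e K / 2]. It degenerates at [e = 0], where [c] is
   instead sent to [0]. *)
have [e_gt0|e_le0] := ltP 0 e.
  have -> : e * (K / 2 + Q / (2 * K)) = e ^+ 2 / (2 * (e / K)) + e / K / 2 * Q.
    by field; rewrite !gt_eqF.
  by apply: young; rewrite divr_gt0.
have ez : e = 0 by apply/eqP; rewrite eq_le e_le0.
rewrite ez mul0r; apply/ler_addgt0Pr => y y0; rewrite add0r.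
(* The denominator is [Q + 1] because [Q] may be [0]; the remaining term is at most [y / 2]. *)
have := young (y / (Q + 1)); rewrite divr_gt0//; last by lra.
move=> /(_ isT)/le_trans; apply; rewrite ez expr0n mul0r add0r.
have : y * (Q / (Q + 1)) <= y.
  by rewrite ler_piMr ?(ltW y0)// ler_pdivrMr; lra.
have : 0 <= y * (Q / (Q + 1)) by rewrite !mulr_ge0 ?invr_ge0 ?(ltW y0)//; lra.
rewrite [y / _ / 2 * Q](_ : _ = y * (Q / (Q + 1)) / 2); first by lra.
by field; rewrite gt_eqF//; lra.
Qed.

End SquareIntegrable.

(** * Expectation of the pathwise bound under the oracle assumptions *)

Lemma measurable_wrtB_cst (d0 : measure_display) (Omega : measurableType d0)
    (R : realType) (F : set (set Omega)) (Y : Omega -> R) (c : R) :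
  measurable_wrt F Y -> measurable_wrt F (fun w => Y w - c).
Proof.
move=> FY B mB.
have mB' : measurable ((fun y : R => y - c) @^-1` B).
  rewrite -[X in measurable X]setTI.
  by apply: (_ : measurable_fun setT (fun y : R => y - c)) => //;
    exact: measurable_funB.
exact: FY mB'.
Qed.

Section ExpectedBound.
Context {R : realType} {d : nat} (f : 'rV[R]_d -> R) (L : R)
  (x0 xstar : 'rV[R]_d) (r : R) (T : nat)
  {d0 d1 : measure_display} {Omega : measurableType d0}
  {Xi : measurableType d1} (P : probability Omega R)
  (G : 'rV[R]_d -> Xi -> 'rV[R]_d) (xi : nat -> Omega -> Xi)
  (F : nat -> set (set Omega)) (b : nat -> Omega -> 'rV[R]_d)
  (sigma : R) (eps : nat -> R).

Let run := accel_run L sigma r T x0 G xi.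

Context (oracle : oracle_assumptions P f G xi run F b sigma eps T).

Let zeta := oracle_error f G xi run.
Let eta t w := zeta t w - b t w.
Let z t w := it_z (run t w).
Let beta := damping L sigma r T.

Lemma run_zS t w :
  z t.+1 w = z t w - (step_a L t / beta) *: response G xi run t w.
Proof. by rewrite /z /run /accel_run it_zS. Qed.

Lemma response_square_integrable t : (t < T)%N ->
  vsquare_integrable P (response G xi run t).
Proof.
move=> /oracle[_ [mG Goo] _ _ _]; apply: vsquare_integrable_lty Goo => i.
by move=> _ B mB; rewrite setTI; exact: mG.
Qed.

Lemma bias_square_integrable t : (t < T)%N -> vsquare_integrable P (b t).
Proof.
move=> /oracle[[FT _] _ bE be _]; apply: vsquare_integrable_lty; last first.
  by apply: le_lt_trans be _; rewrite ltry.
by move=> i; apply: (measurable_wrtW FT); case: (bE i).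
Qed.

(** The conditional variance being given by [is_condexp], integrability of [|zeta_t - b_t|^2] is
    part of the assumptions. *)
Lemma noise_square_integrable t : (t < T)%N -> vsquare_integrable P (eta t).
Proof.
move=> tT; have sb := bias_square_integrable tT.
have [_ _ bE _ [V [[iV _ _ _] _]]] := oracle tT.
apply: vsquare_integrable_enorm => // i.
rewrite (_ : (fun w => _) = fun w => zeta t w 0 i - b t w 0 i); last first.
  by apply/funext => w; rewrite !mxE.
apply: measurable_funB; last by case: (sb i).
by case: (bE i) => /(measurable_int P)/measurable_EFinP.
Qed.

(** The whole space belongs to [F t], so [V] and [|eta_t|^2] have the same expectation. *)
Lemma noise_second_moment t : (t < T)%N ->
  \int[P]_w (enorm (eta t w) ^+ 2) <= sigma ^+ 2.
Proof.
move=> tT; have [[[sF _] _] _ _ _ [V [[iV _ iV' VE] Vle]]] := oracle tT.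
have FT : F t setT by have [F0 FC _] := sF; rewrite -(setD0 setT); exact: FC.
rewrite /Rintegral -VE//.
rewrite -lee_fin fineK; last exact: integrable_fin_num.
have mV : measurable_fun setT V by apply/measurable_EFinP; exact: measurable_int iV'.
(* A version [V] of the conditional variance may be negative at some outcomes; truncating it at [0]
   gives access to almost-everywhere comparison of nonnegative integrands. *)
have mV0 : measurable_fun setT (fun w => Num.max (V w) 0) by exact: measurable_maxr.
have iV0 : P.-integrable setT (EFin \o (fun w => Num.max (V w) 0)).
  apply: le_integrable (iV') => //; first exact/measurable_EFinP.
  move=> w _; rewrite lee_fin; case: (lerP (V w) 0) => // _.
  by rewrite normr0.
apply: (@le_trans _ _ (\int[P]_w (Num.max (V w) 0)%:E)%E).
  by apply: le_integral => // w _; rewrite lee_fin le_max lexx.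
apply: (@le_trans _ _ (\int[P]_w (sigma ^+ 2)%:E)%E); last first.
  by rewrite integral_cst//= probability_setT mule1.
apply: ae_ge0_le_integral => //.
- by move=> w _; rewrite lee_fin le_max lexx orbT.
- exact/measurable_EFinP.
- by move=> w _; rewrite lee_fin sqr_ge0.
- by apply: filterS Vle => w Vw _; rewrite lee_fin ge_max Vw sqr_ge0.
Qed.

Lemma iterate_square_integrable t : (t <= T)%N -> vsquare_integrable P (z t).
Proof.
elim: t => [_|t IH tT].
  rewrite (_ : z 0 = fun=> x0); first exact: vsquare_integrable_cst.
  by apply/funext.
rewrite (_ : z t.+1 = fun w => z t w - (step_a L t / beta) *: response G xi run t w).
  apply: vsquare_integrableB; first by apply: IH; exact: ltnW.
  by apply: vsquare_integrableZ; exact: response_square_integrable.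
by apply/funext => w; exact: run_zS.
Qed.

Lemma noise_orthogonal t : (t < T)%N ->
  \int[P]_w dotv (eta t w) (z t w - xstar) = 0.
Proof.
move=> tT; have sh := noise_square_integrable tT.
have sz : vsquare_integrable P (fun w => z t w - xstar).
  by apply: vsquare_integrableB; [apply: iterate_square_integrable; exact: ltnW
    |exact: vsquare_integrable_cst].
have [_ ->] := integrable_dotv sh sz.
apply: big1 => i _.
have [[FT [_ _ _ Fz _]] _ bE _ _] := oracle tT.
have e : (fun w => eta t w 0 i * (z t w - xstar) 0 i) =
    (fun w => (zeta t w 0 i - b t w 0 i) * (z t w 0 i - xstar 0 i)).
  by apply/funext => w; rewrite !mxE.
rewrite e; apply: (condexp_orthogonal FT (bE i)); last first.
  by have := square_integrableM (sh i) (sz i); rewrite e.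
apply: measurable_wrtB_cst; exact: Fz.
Qed.

Definition mean_sqr_dist t := \int[P]_w (enorm (z t w - xstar) ^+ 2).

Context (L_gt0 : 0 < L) (lambda K : R) (lambda_gt0 : 0 < lambda) (K_gt0 : 0 < K)
  (eps_ge0 : forall t, (t < T)%N -> 0 <= eps t).

Let err t w :=
  step_error L lambda xstar (eta^~ w) (b^~ w) (z t w) (z t.+1 w) t.

Lemma step_error_le t : (t < T)%N ->
  P.-integrable setT (EFin \o err t) /\
  \int[P]_w err t w <= step_a L t ^+ 2 / (2 * lambda) * sigma ^+ 2
    + step_a L t * eps t * (K / 2 + mean_sqr_dist t.+1 / (2 * K)).
Proof.
move=> tT; have sh := noise_square_integrable tT.
have sb := bias_square_integrable tT.
have sz s : (s <= T)%N -> vsquare_integrable P (fun w => z s w - xstar).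
  by move=> sT; apply: vsquare_integrableB; [exact: iterate_square_integrable
    |exact: vsquare_integrable_cst].
have iH := integrable_enorm_sqr sh.
have [iO _] := integrable_dotv sh (sz _ (ltnW tT)).
have [iB _] := integrable_dotv sb (sz _ tT).
have a0 : 0 < step_a L t by exact: step_a_gt0.
rewrite /err /step_error.
set c := step_a L t ^+ 2 / (2 * lambda).
have c0 : 0 <= c by rewrite divr_ge0 ?sqr_ge0// mulr_ge0// ltW.
have iH' : P.-integrable setT (EFin \o (fun w => c * enorm (eta t w) ^+ 2)).
  exact: integrableZl iH.
have iO' : P.-integrable setT
    (EFin \o (fun w => step_a L t * dotv (eta t w) (z t w - xstar))).
  exact: integrableZl iO.
have iB' : P.-integrable setT
    (EFin \o (fun w => step_a L t * dotv (b t w) (z t.+1 w - xstar))).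
  exact: integrableZl iB.
have iHO := integrableB measurableT iH' iO'.
split; first exact: integrableB iHO iB'.
rewrite RintegralB// RintegralB// !RintegralZl// noise_orthogonal// mulr0 subr0.
apply: lerD; first by rewrite ler_wpM2l// noise_second_moment.
rewrite -mulrN -mulrA ler_wpM2l ?(ltW a0)//.
have [_ _ _ be _] := oracle tT.
exact: Rintegral_dotv_ge sb (sz _ tT) (eps_ge0 tT) K_gt0 be.
Qed.

(** An implicit bound: the unknown [mean_sqr_dist] occurs in it up to index [n] itself, which
    [self_bounded_le] resolves. *)
Definition mean_bound n := beta / 2 * enorm (x0 - xstar) ^+ 2
  + \sum_(t < n) (step_a L t ^+ 2 / (2 * lambda) * sigma ^+ 2
    + step_a L t * eps t * (K / 2 + mean_sqr_dist t.+1 / (2 * K))).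

Let bound n w := beta / 2 * enorm (x0 - xstar) ^+ 2 + \sum_(t < n) err t w.

Lemma mean_bound_ge n : (n <= T)%N ->
  P.-integrable setT (EFin \o bound n) /\ \int[P]_w bound n w <= mean_bound n.
Proof.
rewrite /mean_bound; elim: n => [_|n IH nT].
  rewrite (_ : bound 0 = fun=> beta / 2 * enorm (x0 - xstar) ^+ 2); last first.
    by apply/funext => w; rewrite /bound big_ord0 addr0.
  rewrite big_ord0 addr0 Rintegral_cst//= probability_setT mulr1.
  by split=> //; exact: finite_measure_integrable_cst.
rewrite (_ : bound n.+1 = fun w => bound n w + err n w); last first.
  by apply/funext => w; rewrite /bound big_ord_recr addrA.
have [iB Ble] := IH (ltnW nT); have [iE Ele] := step_error_le nT.
rewrite big_ord_recr addrA /=; split; first exact: integrableD iB iE.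
by rewrite RintegralD//; exact: lerD.
Qed.

Context (f_convex : convex_function [set: convex_lmodType 'rV[R]_d] f)
  (f_differentiable : forall x, differentiable f x)
  (f_smooth : forall x y,
    enorm (gradient f x - gradient f y) <= L * enorm (x - y))
  (xstar_argmin : forall y, f xstar <= f y)
  (beta_ge : lambda <= beta - 5 / 16).

Lemma run_bound n w : (n <= T)%N ->
  (\sum_(i < n) step_a L i) * (f (it_x (run n w)) - f xstar)
    + beta / 2 * enorm (z n w - xstar) ^+ 2 <= bound n w.
Proof.
move=> nT.
apply: (pathwise_bound f_convex f_differentiable L_gt0 f_smooth lambda_gt0 beta_ge).
move=> t tn; rewrite /eta /zeta /oracle_error /response -/(run t w).
by rewrite -addrA subrK addrC subrK.
Qed.

(** Of the two nonnegative terms on the left of [run_bound], this keeps the distance and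
    [expected_gap_le] keeps the function gap. *)
Lemma mean_sqr_dist_le n : (n <= T)%N -> beta / 2 * mean_sqr_dist n <= mean_bound n.
Proof.
move=> nT; have [iB Ble] := mean_bound_ge nT; apply: le_trans Ble.
have sz : vsquare_integrable P (fun w => z n w - xstar).
  by apply: vsquare_integrableB; [exact: iterate_square_integrable
    |exact: vsquare_integrable_cst].
have iz := integrable_enorm_sqr sz.
rewrite -RintegralZl//; apply: le_Rintegral => //; first exact: integrableZl iz.
move=> w _; apply: le_trans (run_bound w nT); rewrite lerDr mulr_ge0//.
  by apply: sumr_ge0 => i _; rewrite ltW// step_a_gt0.
by rewrite subr_ge0.
Qed.

(* The integral of a nonnegative function is monotone without measurability, so
   the composite of f with the last iterate need not be shown measurable. *)
Lemma le_expectation_ge0 (X Y : Omega -> R) :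
  (forall w, 0 <= X w <= Y w) -> ('E_P[X] <= 'E_P[Y])%E.
Proof.
move=> XY; rewrite unlock !ge0_integralTE.
- apply: le_ereal_sup => _ [h hX <-]; exists h => // w.
  by apply: le_trans (hX w) _; rewrite lee_fin; case/andP: (XY w).
- by move=> w; rewrite lee_fin; case/andP: (XY w) => /le_trans; apply.
- by move=> w; rewrite lee_fin; case/andP: (XY w).
Qed.

Lemma expected_gap_le : (0 < T)%N ->
  ('E_P[fun w => (f (it_x (run T w)) - f xstar)%R] <=
    (mean_bound T / sum_A L T.-1)%:E)%E.
Proof.
move=> T0; have [iB Ble] := mean_bound_ge (leqnn T).
have AE : sum_A L T.-1 = \sum_(i < T) step_a L i by rewrite /sum_A prednK.
have A0 : 0 < sum_A L T.-1 by exact: sum_A_gt0.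
have b0 : 0 <= beta by move: lambda_gt0 beta_ge => l0 lb; lra.
apply: (@le_trans _ _ ('E_P[fun w => ((sum_A L T.-1)^-1 * bound T w)%R])%E).
  apply: le_expectation_ge0 => w; rewrite subr_ge0 xstar_argmin/= mulrC.
  rewrite ler_pdivlMr// mulrC AE; apply: le_trans (run_bound w (leqnn T)).
  by rewrite lerDl mulr_ge0 ?sqr_ge0// divr_ge0.
rewrite expectation_Rintegral; last exact: integrableZl iB.
by rewrite lee_fin RintegralZl// mulrC ler_pM2r// invr_gt0.
Qed.

End ExpectedBound.

(** * Closing the implicit bound on the mean square distances *)

Lemma sum_ord_le (R : numDomainType) (g : nat -> R) (n T : nat) : (n <= T)%N ->
  (forall t, (t < T)%N -> 0 <= g t) -> \sum_(t < n) g t <= \sum_(t < T) g t.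
Proof.
move=> nT g0; rewrite -(subnKC nT) big_split_ord /= lerDl.
by apply: sumr_ge0 => t _; apply: g0; rewrite -[X in (_ < X)%N](subnKC nT) ltn_add2l.
Qed.

Lemma self_bounded_le (R : realType) (T : nat) (D c : nat -> R) (C S K r beta : R) :
  (forall t, 0 <= D t) -> (forall t, (t < T)%N -> 0 <= c t) ->
  S = \sum_(t < T) c t -> K = 2 * r + 2 * S -> 0 < r -> 1 <= beta ->
  C <= beta * r ^+ 2 ->
  (forall n, (n <= T)%N ->
    beta / 2 * D n <= C + \sum_(t < n) c t * (K / 2 + D t.+1 / (2 * K))) ->
  forall n, (n <= T)%N -> D n <= K ^+ 2.
Proof.
move=> D0 c0 SE KE r0 b1 Cle rec.
have S0 : 0 <= S by rewrite SE; apply: sumr_ge0 => t _; exact: c0.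
have K0 : 0 < K by lra.
(* At an index of maximal [D], every [D t.+1] on the right of the recursion is at most the left-hand
   unknown [Q]. *)
have [n0 [n0T maxD]] : exists n0, (n0 <= T)%N /\ forall n, (n <= T)%N -> D n <= D n0.
  exists [arg max_(i > (ord0 : 'I_T.+1)) D i]%O; case: arg_maxP => //= i _ imax.
  by split=> [|n nT]; [rewrite -ltnS | exact: (imax (Ordinal (nT : (n < T.+1)%N)))].
move=> n /maxD /le_trans; apply; move: (rec _ n0T) => {}rec.
have Q0 := D0 n0; set Q := D n0 in rec maxD Q0 *.
have Y0 : 0 <= K / 2 + Q / (2 * K).
  by rewrite addr_ge0// divr_ge0//; lra.
have sumle : \sum_(t < n0) c t * (K / 2 + D t.+1 / (2 * K)) <=
    S * (K / 2 + Q / (2 * K)).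
  rewrite SE mulr_suml.
  pose g t := c t * (K / 2 + Q / (2 * K)).
  apply: le_trans (sum_ord_le (g := g) n0T _); last first.
    by move=> t tT; rewrite /g mulr_ge0// c0.
  apply: ler_sum => t _; have tT := leq_trans (ltn_ord t) n0T.
  rewrite ler_wpM2l ?c0// lerD2l ler_pM2r ?invr_gt0 ?mulr_gt0//.
  exact: maxD.
(* Since [K >= 2 S], half of the left-hand side [beta / 2 * Q] absorbs this term. *)
have quarter : S * (Q / (2 * K)) <= Q / 4.
  rewrite [leLHS](_ : _ = Q * (S / (2 * K))); last by field; rewrite gt_eqF.
  by rewrite ler_wpM2l// ler_pdivrMr; lra.
have Qb : Q <= beta * Q by rewrite ler_peMl.
have SKb : S * K <= beta * (S * K) by rewrite ler_peMl// mulr_ge0// ltW.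
(* With [beta] cancelled, [4 r^2 + 2 S K = 4 r^2 + 4 r S + 4 S^2] is below
   [K^2 = 4 r^2 + 8 r S + 4 S^2]. *)
have : beta * Q <= beta * (4 * r ^+ 2 + 2 * (S * K)) by lra.
rewrite ler_pM2l; last by lra.
move=> /le_trans; apply; rewrite KE; have := mulr_ge0 S0 (ltW r0).
by have := sqr_ge0 S; lra.
Qed.

(** * Rates given by the explicit step sizes *)

Section Rate.
Context {R : realType} (L sigma r : R) (T : nat).
Context (L_gt0 : 0 < L) (r_gt0 : 0 < r) (sigma_ge0 : 0 <= sigma) (T_gt0 : (0 < T)%N).

Lemma step_norm_sqr : step_norm L T ^+ 2 = \sum_(i < T) step_a L i ^+ 2.
Proof. by rewrite sqr_sqrtr// sumr_ge0// => i _; rewrite sqr_ge0. Qed.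

(** Each [a_i] with [i < T] is at most [T / (128 L)], so [H_{T-1}] is at most [T sqrt T / (128 L)],
    while [A_{T-1} = T (T + 1) / (256 L)]. *)
Lemma step_norm_le : step_norm L T <= 2 / Num.sqrt T%:R * sum_A L T.-1.
Proof.
have T0 : 0 < T%:R :> R by rewrite ltr0n.
have : 0 < Num.sqrt (T%:R : R) by rewrite sqrtr_gt0.
have : Num.sqrt T%:R ^+ 2 = T%:R :> R by rewrite sqr_sqrtr// ltW.
move: (Num.sqrt T%:R) => q q2 q0.
have rhs0 : 0 <= T%:R * q / (128 * L) by rewrite divr_ge0 ?mulr_ge0 ?ltW// mulr_gt0.
apply: (@le_trans _ _ (T%:R * q / (128 * L))).
  rewrite -(@ler_pXn2r _ 2) ?nnegrE ?sqrtr_ge0// step_norm_sqr.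
  apply: (@le_trans _ _ (\sum_(i < T) (T%:R / (128 * L)) ^+ 2)).
    apply: ler_sum => i _; have l0 : 0 < 128 * L by rewrite mulr_gt0.
    rewrite /step_a ler_pXn2r ?nnegrE ?divr_ge0 ?(ltW l0)//.
    by rewrite ler_pM2r ?invr_gt0// ler_nat.
  rewrite sumr_const card_ord -[_ ^+ 2 *+ T]mulr_natr -q2.
  rewrite le_eqVlt; apply/orP; left; apply/eqP.
  by field; rewrite gt_eqF.
rewrite sum_AE prednK// -(natr1 T) -q2.
rewrite [leRHS](_ : _ = q * (q ^+ 2 + 1) / (128 * L)); last first.
  by field; rewrite !gt_eqF.
rewrite ler_pM2r ?invr_gt0 ?mulr_gt0// mulrC ler_pM2l//; lra.
Qed.

Lemma initial_rate_le : r ^+ 2 / 2 / sum_A L T.-1 <= 128 * L * r ^+ 2 / T%:R ^+ 2.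
Proof.
have T0 : 0 < T%:R :> R by rewrite ltr0n.
rewrite sum_AE prednK// -(natr1 T); move: (T%:R : R) T0 => u u0.
rewrite [leLHS](_ : _ = 128 * L * r ^+ 2 / u ^+ 2 * (u / (u + 1))); last first.
  by field; rewrite !gt_eqF//; lra.
rewrite ler_piMr//; last by rewrite ler_pdivrMr; lra.
by rewrite divr_ge0 ?sqr_ge0// !mulr_ge0// ?sqr_ge0// ltW.
Qed.

Lemma double_sum_A_le : 2 * sum_A L T.-1 <= 64 / L * T%:R ^+ 4.
Proof.
have T1 : 1 <= T%:R :> R by rewrite ler1n.
rewrite sum_AE prednK// -(natr1 T); move: (T%:R : R) T1 => u u1.
rewrite [leLHS](_ : _ = L^-1 * (u * (u + 1) / 128)); last by field; rewrite gt_eqF.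
rewrite [leRHS](_ : _ = L^-1 * (64 * u ^+ 4)); last by field; rewrite gt_eqF.
rewrite ler_pM2l ?invr_gt0//.
have u2 : u <= u ^+ 2 by rewrite expr2 ler_peMr; lra.
have : u ^+ 2 <= u ^+ 4 by rewrite ler_weXn2l.
lra.
Qed.

(** Substituting [S = A_{T-1} Gamma_T] gives [2 r Gamma_T + 2 A_{T-1} Gamma_T^2], compared summand
    by summand with the bias error. *)
Lemma bias_rate_le (eps : nat -> R) (S : R) :
  (forall t, (t < T)%N -> 0 <= eps t) -> S = \sum_(t < T) step_a L t * eps t ->
  S * (2 * r + 2 * S) / sum_A L T.-1 <= bias_error L sigma r eps T.
Proof.
move=> eps0 SE; have A0 := sum_A_gt0 L_gt0 T.-1.
have S0 : 0 <= S; first rewrite SE.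
  by apply: sumr_ge0 => t _; rewrite mulr_ge0 ?eps0// ltW// step_a_gt0.
rewrite /bias_error /mean_bias -SE; set g := S / _.
have g0 : 0 <= g by rewrite divr_ge0// ltW.
have {}SE : S = sum_A L T.-1 * g by rewrite mulrC divfK// gt_eqF.
have -> : S * (2 * r + 2 * S) / sum_A L T.-1 =
    2 * r * g + 2 * sum_A L T.-1 * g ^+ 2.
  by rewrite SE; field; rewrite gt_eqF.
apply: lerD; last by rewrite ler_wpM2r ?sqr_ge0// double_sum_A_le.
rewrite ler_wpM2r//.
have T1 : 1 <= T%:R :> R by rewrite ler1n.
have : 0 <= Num.sqrt (sigma * r / L) * T%:R `^ (3 / 4).
  by rewrite mulr_ge0 ?sqrtr_ge0 ?powR_ge0.
move: (Num.sqrt _ * _) => v v0.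
have : 2 ^+ 11 * (r + v) <= 2 ^+ 11 * (r + v) * T%:R.
  by rewrite ler_peMr// mulr_ge0 ?exprn_ge0 ?addr_ge0// ltW.
have : 2 <= 2 ^+ 11 :> R by rewrite -[leLHS]expr1 ler_eXn2l// ltr1n.
move: (2 ^+ 11 : R) (_ * T%:R) => p q p2 /(le_trans _); apply.
have p0 : 0 <= p by lra.
by have := ler_wpM2r (ltW r_gt0) p2; have := mulr_ge0 p0 v0; lra.
Qed.

End Rate.

(** * Choice of the constants and final estimate *)

(** Used with [h = H_{T-1}] and [s = beta - 1]: the left-hand side is [s^2 r^2 / (2 lambda)], and
    [s <= lambda] removes one factor [s]. *)
Lemma variance_term_le (R : realFieldType) (r s h sigma lambda : R) :
  0 < r -> 0 <= s -> s <= lambda -> 0 < lambda -> sigma * h = s * r ->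
  h ^+ 2 / (2 * lambda) * sigma ^+ 2 <= s * r ^+ 2 / 2.
Proof.
move=> r0 s0 sl l0 e.
rewrite [leLHS](_ : _ = s * r ^+ 2 / 2 * (s / lambda)); last first.
  rewrite [LHS](_ : _ = (sigma * h) ^+ 2 / (2 * lambda)).
    by rewrite e; field; rewrite gt_eqF.
  by field; rewrite gt_eqF.
have sr0 : 0 <= s * r ^+ 2 / 2 by rewrite divr_ge0// mulr_ge0// sqr_ge0.
by rewrite ler_piMr// ler_pdivrMr// mul1r.
Qed.

Lemma ler_sqr_enorm (R : realType) (d : nat) (u : 'rV[R]_d) (r : R) :
  enorm u <= r -> enorm u ^+ 2 <= r ^+ 2.
Proof.
by move=> ur; rewrite ler_pXn2r ?nnegrE ?enorm_ge0// (le_trans (enorm_ge0 u)).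
Qed.

Theorem theorem3 (R : realType) (d : nat)
  (f : 'rV[R]_d -> R) (L : R) (x0 xstar : 'rV[R]_d) (r : R) (T : nat)
  (d0 d1 : measure_display) (Omega : measurableType d0)
  (Xi : measurableType d1) (P : probability Omega R)
  (G : 'rV[R]_d -> Xi -> 'rV[R]_d) (xi : nat -> {RV P >-> Xi})
  (F : nat -> set (set Omega)) (b : nat -> Omega -> 'rV[R]_d)
  (sigma : R) (eps : nat -> R)
  (f_convex : convex_function [set: convex_lmodType 'rV[R]_d] f)
  (f_differentiable : forall x, differentiable f x)
  (L_gt0 : 0 < L)
  (f_smooth : forall x y,
    enorm (gradient f x - gradient f y) <= L * enorm (x - y))
  (xstar_argmin : forall y, f xstar <= f y)
  (r_gt0 : 0 < r) (r_ge : enorm (x0 - xstar) <= r)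
  (T_ge1 : (1 <= T)%N)
  (sigma_ge0 : 0 <= sigma)
  (eps_ge0 : forall t, (t < T)%N -> 0 <= eps t)
  (oracle : oracle_assumptions P f G xi (accel_run L sigma r T x0 G xi)
     F b sigma eps T) :
  ('E_P[fun w => (f (it_x (accel_run L sigma r T x0 G xi T w)) - f xstar)%R] <=
     (6 * sigma * r / Num.sqrt T%:R + 128 * L * r ^+ 2 / T%:R ^+ 2
        + bias_error L sigma r eps T)%:E)%E
  /\
  ((forall t, (t < T)%N -> eps t = 0) ->
     bias_error L sigma r eps T = 0 /\
     ('E_P[fun w => (f (it_x (accel_run L sigma r T x0 G xi T w)) - f xstar)%R]
        <= (6 * sigma * r / Num.sqrt T%:R
              + 128 * L * r ^+ 2 / T%:R ^+ 2)%:E)%E).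
Proof.
set beta := damping L sigma r T.
have H0 : 0 <= step_norm L T by exact: sqrtr_ge0.
have [s [sE s0]] : exists s, sigma / r * step_norm L T = s /\ 0 <= s.
  by exists (sigma / r * step_norm L T); split;
    rewrite ?mulr_ge0 ?invr_ge0 ?(ltW r_gt0).
have betaE : beta = 1 + s by rewrite /beta /damping sE.
(* The largest value that [mirror_step] allows; it equals [s + 11 / 16], hence is positive even when
   [sigma = 0]. *)
have [lambda [lE sl l0]] : exists lambda,
    [/\ lambda = beta - 5 / 16, s <= lambda & 0 < lambda].
  by exists (beta - 5 / 16); split => //; lra.
have a0 t : 0 <= step_a L t by rewrite ltW// step_a_gt0.
have [S SE] : exists S, S = \sum_(t < T) step_a L t * eps t by eexists.
have S0 : 0 <= S by rewrite SE; apply: sumr_ge0 => t _; rewrite mulr_ge0 ?eps_ge0.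
have [K KE] : exists K, K = 2 * r + 2 * S by eexists.
have K0 : 0 < K by lra.
pose D := mean_sqr_dist L x0 xstar r T P G xi sigma.
have D0 t : 0 <= D t by apply: Rintegral_ge0 => w _; rewrite sqr_ge0.
(* [C] collects [beta r^2 / 2 = r^2 / 2 + s r^2 / 2] from the start and [s r^2 / 2] from the
   variance. *)
have [C CE] : exists C, C = r ^+ 2 / 2 + s * r ^+ 2 by eexists.
have boundE n : (n <= T)%N ->
    mean_bound L x0 xstar r T P G xi sigma eps lambda K n <=
    C + \sum_(t < n) step_a L t * eps t * (K / 2 + D t.+1 / (2 * K)).
  move=> nT; rewrite /mean_bound big_split /= addrA lerD2r -/beta.
  apply: (@le_trans _ _ (beta / 2 * r ^+ 2 + s * r ^+ 2 / 2)); last first.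
    by rewrite CE betaE; lra.
  apply: lerD.
    by apply: ler_wpM2l; [rewrite betaE; lra|exact: ler_sqr_enorm].
  rewrite -mulr_suml -mulr_suml.
  have sr : sigma * step_norm L T = s * r by rewrite -sE; field; rewrite gt_eqF.
  apply: le_trans (variance_term_le r_gt0 s0 sl l0 sr).
  rewrite ler_wpM2r ?sqr_ge0// ler_wpM2r ?invr_ge0 ?mulr_ge0 ?(ltW l0)//.
  rewrite step_norm_sqr; apply: (sum_ord_le (g := fun i => step_a L i ^+ 2)) => // t _.
  exact: sqr_ge0.
have dist_le n : (n <= T)%N -> beta / 2 * D n <=
    C + \sum_(t < n) step_a L t * eps t * (K / 2 + D t.+1 / (2 * K)).
  move=> nT; apply: le_trans (boundE n nT).
  apply: (mean_sqr_dist_le oracle) => //; by rewrite -/beta lE.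
have C_le : C <= beta * r ^+ 2.
  by rewrite CE betaE; have := sqr_ge0 r; lra.
have DK : forall n, (n <= T)%N -> D n <= K ^+ 2.
  apply: (self_bounded_le (c := fun t => step_a L t * eps t) D0 _ SE KE r_gt0 _
    C_le dist_le).
    by move=> t tT /=; rewrite mulr_ge0 ?eps_ge0.
  by rewrite betaE; lra.
(* Once [D <= K^2], each factor [K / 2 + D / (2 K)] is at most [K]. *)
have final : mean_bound L x0 xstar r T P G xi sigma eps lambda K T <= C + S * K.
  apply: le_trans (boundE T (leqnn T)) _; rewrite lerD2l SE mulr_suml.
  apply: ler_sum => t _; apply: ler_wpM2l; first by rewrite mulr_ge0 ?eps_ge0.
  have : D t.+1 / (2 * K) <= K ^+ 2 / (2 * K).
    by rewrite ler_wpM2r ?DK// invr_ge0 mulr_ge0// ltW.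
  rewrite [K ^+ 2 / _](_ : _ = K / 2); last by field; rewrite gt_eqF.
  by lra.
have A0 := sum_A_gt0 L_gt0 T.-1.
have main : ('E_P[fun w => (f (it_x (accel_run L sigma r T x0 G xi T w)) - f xstar)%R]
    <= (6 * sigma * r / Num.sqrt T%:R + 128 * L * r ^+ 2 / T%:R ^+ 2
        + bias_error L sigma r eps T)%:E)%E.
  apply: le_trans.
    by apply: (expected_gap_le oracle L_gt0 l0 K0) => //; rewrite -/beta lE.
  rewrite lee_fin; apply: (@le_trans _ _ ((C + S * K) / sum_A L T.-1)).
    by rewrite ler_pM2r ?invr_gt0.
  rewrite mulrDl; apply: lerD; last by rewrite KE; exact: bias_rate_le.
  rewrite CE mulrDl addrC; apply: lerD; last exact: initial_rate_le.
  (* By [step_norm_le] this part contributes at most [2 sigma r / sqrt T], within the claimed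
     constant [6]. *)
  have -> : s * r ^+ 2 = sigma * r * step_norm L T.
    by rewrite -sE; field; rewrite gt_eqF.
  have sr0 : 0 <= sigma * r by rewrite mulr_ge0// ltW.
  have := ler_wpM2l sr0 (step_norm_le L_gt0 T_ge1).
  rewrite -(ler_pM2r (_ : 0 < (sum_A L T.-1)^-1)) ?invr_gt0// => /le_trans; apply.
  rewrite [leLHS](_ : _ = 2 * (sigma * r / Num.sqrt T%:R)); last first.
    rewrite !mulrA mulfK ?gt_eqF//; ring.
  have : 0 <= sigma * r / Num.sqrt T%:R by rewrite divr_ge0 ?sqrtr_ge0.
  by rewrite -!mulrA; lra.
split=> // eps0.
have bias0 : bias_error L sigma r eps T = 0.
  have mean0 : mean_bias L eps T = 0.
    by rewrite /mean_bias big1 ?mul0r// => t _; rewrite eps0// mulr0.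
  by rewrite /bias_error mean0 expr0n !mulr0 addr0.
by split=> //; rewrite bias0 addr0 in main.
Qed.
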